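(* The discriminant of a quadrinomial $f(x)=x^n+ax^3+bx+c$ with $a,b,c\in\mathbb{C}$ such that $abc\neq 0$ and $n>4$ is given by \begin{align*} \Delta(f)=&(-1)^{\frac{(n-1)(n+2)}{2}}a^{n-3}(n-3)^{n-3}(3a+nt_{n-2})^3\\ &\cdot\Bigg(\left(\frac{a(n-3)}{n}\right)^2e_2^3+\frac{ab(n-1)(n-3)}{n^2}(e_1^2-2e_2)e_2\\ &\quad+\frac{ac(n-3)}{n}(e_1^3-3e_1e_2)+\left(\frac{b(n-1)}{n}\right)^2e_2+\frac{bc(n-1)}{n}e_1+c^2\Bigg), \end{align*} where $e_1=-\frac{nt_{n-1}}{3a+nt_{n-2}}$, $e_2=\frac{ab(n-3)-cn^2t_{n-3}}{a(n-3)(3a+nt_{n-2})}$ and the sequence $(t_r)$ is expressed as $$t_r=\begin{cases}\left(\frac{n}{a(n-3)}\right)^{\lceil\frac r2\rceil}\displaystyle\sum_{k=0}^{\lfloor\frac r6\rfloor}\binom{\lfloor\frac r2\rfloor-k}{\lfloor\frac r2\rfloor-3k}c^{2k}\left(\frac{b(n-1)}{n}\right)^{\lfloor\frac r2\rfloor-3k}\left(\frac{a(n-3)}{n}\right)^k, & 2\nmid r,\\[2mm] \left(\frac{n}{a(n-3)}\right)^{\frac r2}\displaystyle\sum_{k=1}^{\lfloor\frac{r+2}{6}\rfloor}\binom{\frac r2-k}{\frac r2-3k+1}c^{2k-1}\left(\frac{b(n-1)}{n}\right)^{\frac r2-3k+1}\left(\frac{a(n-3)}{n}\right)^{k-1},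 & 2\mid r.\end{cases}$$
   Context: Here $n$ is an integer and the index $r$ runs over the positive integers; empty sums are $0$. For a polynomial $f(x)=a_nx^n+\dots+a_0\in\mathbb{C}[x]$ of degree $n\geq 1$ with roots $\xi_1,\dots,\xi_n\in\mathbb{C}$ (listed with multiplicity), the discriminant is $\Delta(f)=a_n^{2n-2}\prod_{1\leq i<j\leq n}(\xi_i-\xi_j)^2$.
   Formalization: The printed t_r fails for x^5+x^3+x+1; here its base n/(a(n-3)) is negated, the exponent ⌈r/2⌉ is ⌊r/2⌋, and (a(n-3)/n)^k (r odd) and (a(n-3)/n)^(k-1) (r even) become (-a(n-3)/n)^k; also 3a+n t_{n-2}≠0 is assumed so that e_1 and e_2 are defined. *)

(* Defs.v *)
From mathcomp Require Import all_boot all_order all_algebra.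
From mathcomp Require Export reals complex.

Set Implicit Arguments.
Unset Strict Implicit.
Unset Printing Implicit Defensive.

Import GRing.Theory.
Local Open Scope ring_scope.

(* The roots of p listed with multiplicity: closed_field_poly_normal gives a
   sequence s with p = lead_coef p *: \prod_(z <- s) ('X - z%:P), which
   determines s up to order as soon as p != 0. *)
Definition croots (F : closedFieldType) (p : {poly F}) : seq F :=
  sval (closed_field_poly_normal p).

Definition discriminant (F : closedFieldType) (p : {poly F}) : F :=
  let s := croots p in
  lead_coef p ^+ (2 * (size p).-1 - 2)
  * \prod_(i < size s) \prod_(j < size s | (i < j)%N) (s`_i - s`_j) ^+ 2.

(* quad_t n a b c r is the coefficient of 'X^2 in the remainder of 'X^r.+1
   modulo the cubic alpha 'X^3 + beta 'X + c, where alpha = a (n - 3) / n and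
   beta = b (n - 1) / n.

   The source prints this sequence with alpha in place of - alpha, with the
   exponent uphalf r in place of r./2 for odd r, and with alpha ^+ (k - 1) in
   place of (- alpha) ^+ k for even r; that is, the t_r below is - alpha times
   the printed expression taken at - alpha.  With the printed t_r
   the discriminant formula fails: for 'X^5 + 'X^3 + 'X + 1, of discriminant
   4477, it gives - 256273 / 8.

   In the binomial and the exponent of the even case, r / 2 - 3 k + 1 is written
   r./2.+1 - 3 * k because it vanishes when 3 k = r / 2 + 1, where the
   truncated r./2 - 3 * k + 1 would be 1. *)
Definition quad_t (F : fieldType) (n : nat) (a b c : F) (r : nat) : F :=
  let alpha := a * (n - 3)%:R / n%:R in
  let beta := b * (n - 1)%:R / n%:R in
  if odd r then
    (- (n%:R / (a * (n - 3)%:R))) ^+ r./2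
    * \sum_(0 <= k < (r %/ 6).+1)
        'C(r./2 - k, r./2 - 3 * k)%:R * c ^+ (2 * k)
        * beta ^+ (r./2 - 3 * k) * (- alpha) ^+ k
  else
    (- (n%:R / (a * (n - 3)%:R))) ^+ r./2
    * \sum_(1 <= k < ((r + 2) %/ 6).+1)
        'C(r./2 - k, r./2.+1 - 3 * k)%:R * c ^+ (2 * k - 1)
        * beta ^+ (r./2.+1 - 3 * k) * (- alpha) ^+ k.

(* Main.v *)
Require Import Defs.
From mathcomp Require Import all_boot all_order all_algebra.
From mathcomp Require Import reals complex.
From mathcomp Require Import zify ring.

Import GRing.Theory.
Local Open Scope ring_scope.

(** Put alpha = a (n - 3) / n, beta = b (n - 1) / n and
    g = alpha x^3 + beta x + c, so that n g = n f - x f'.  At the roots of f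
    this reads x f' = - n g, whence the product of f' over the roots of f,
    which is the discriminant up to sign, is a multiple of the resultant of f
    and g.  At the roots of g it reads n f = x f', and modulo g the derivative
    f' reduces to the quadratic A (x^2 - e1 x + e2) with
    A = 3 a + n t_(n-2), since t_r, t_(r+1) and - (c / alpha) t_(r-1) are the
    coefficients of x^(r+1) modulo g.  What remains is the product of
    x^2 - e1 x + e2 over the roots of g, a symmetric function of them. *)

(** * The derivative at the roots of a split polynomial *)

Lemma prod_horner_deriv (R : comNzRingType) (s : seq R) :
  let p := \prod_(z <- s) ('X - z%:P) in
  \prod_(z <- s) p^`().[z]
  = (-1) ^+ 'C(size s, 2)
    * \prod_(i < size s) \prod_(j < size s | (i < j)%N) (s`_i - s`_j) ^+ 2.
Proof.
move=> /=; elim: s => [|x s IHs]; first by rewrite !big_nil big_ord0 mulr1.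
set q := \prod_(z <- s) ('X - z%:P) in IHs.
have -> : \prod_(z <- x :: s) ('X - z%:P) = ('X - x%:P) * q by rewrite big_cons.
have qE y : q.[y] = \prod_(z <- s) (y - z).
  by rewrite horner_prod; apply: eq_bigr => z _; rewrite !hornerE.
rewrite derivM derivXsubC mul1r big_cons !hornerE subrr mul0r addr0 /=.
(* With p = (X - x) q, p' takes the value q(x) at x and (z - x) q'(z) at a root z of q, so the
   induction hypothesis on q' applies. *)
have -> : \prod_(z <- s) (q + ('X - x%:P) * q^`()).[z]
    = \prod_(z <- s) (z - x) * \prod_(z <- s) q^`().[z].
  rewrite -big_split /= !big_seq; apply: eq_bigr => z zs.
  have q0 : q.[z] = 0.
    by rewrite qE (big_rem z) //= subrr mul0r.
  by rewrite !hornerE q0 add0r.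
rewrite IHs qE big_ord_recl /=.
rewrite [X in _ = _ * (X * _)]big_mkcond big_ord_recl /= mul1r.
(* Each pair containing x contributes (x - z)^2 = - (x - z)(z - x). These [size s] signs are the
   increment from 'C(size s, 2) to 'C((size s).+1, 2). *)
have -> : \prod_(i < size s) (if (0 < bump 0 i)%N then (x - s`_i) ^+ 2 else 1)
    = (-1) ^+ size s * (\prod_(z <- s) (x - z) * \prod_(z <- s) (z - x)).
  rewrite -big_split /= (big_nth 0) big_mkord.
  rewrite -[X in (-1) ^+ X]card_ord -prodrN; apply: eq_bigr => i _ /=.
  by ring.
under [X in _ = _ * (_ * X)]eq_bigr => i _.
  rewrite big_mkcond big_ord_recl /= mul1r -big_mkcond /=.
  under eq_bigl => j do rewrite ltnS.
  over.
rewrite binS bin1 exprD !mulrA; set u := (-1) ^+ size s.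
have uu : u * u = 1 by rewrite -expr2 sqrr_sign.
rewrite -[LHS]mul1r -uu.
ring.
Qed.

(** * The sequence t_r and powers modulo the cubic, where x^3 = p x + q *)

Section QuadT.

Variables (F : fieldType) (n : nat) (a b c : F).

Let alpha := a * (n - 3)%:R / n%:R.
Let beta := b * (n - 1)%:R / n%:R.
Let p := - (beta / alpha).
Let q := - (c / alpha).

(* t_(2m+1) and t_(2m) rewritten with the binomials C(m - k, 2k) and
   C(m - k, 2k - 1), the index k shifted by one in the even case: these vanish
   past the range of the original sums, so the upper bound N is free and the
   recurrence holds term by term by Pascal's rule. *)
Definition odd_quad_t m N : F :=
  \sum_(0 <= k < N) 'C(m - k, 2 * k)%:R * q ^+ (2 * k) * p ^+ (m - 3 * k).

Definition even_quad_t m N : F :=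
  \sum_(0 <= k < N)
    'C(m - k.+1, (2 * k).+1)%:R * q ^+ (2 * k).+1 * p ^+ (m.+1 - 3 * k.+1).

Lemma odd_quad_tS m N :
  odd_quad_t m.+1 N.+1 = p * odd_quad_t m N.+1 + q * even_quad_t m N.
Proof.
rewrite /odd_quad_t /even_quad_t big_nat_recl //= [X in p * X]big_nat_recl //=.
rewrite !muln0 !subn0 !bin0 mulrDr -addrA; congr (_ + _).
  by rewrite !mul1r exprS.
rewrite !mulr_sumr -big_split; apply: eq_bigr => k _ /=.
case: (leqP k.+1 m) => km; last first.
  by rewrite !bin_small; [ring|lia..].
have -> : (m.+1 - k.+1 = (m - k.+1).+1)%N by lia.
have -> : (2 * k.+1 = (2 * k).+2)%N by lia.
rewrite binS natrD.
case: (leqP (3 * k.+1) m) => k3.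
  have -> : (m.+1 - 3 * k.+1 = (m - 3 * k.+1).+1)%N by lia.
  by rewrite !exprS; ring.
(* Here the truncated exponents of p no longer differ by one; the binomial of the offending term is
   zero. *)
rewrite (_ : 'C(m - k.+1, (2 * k).+2) = 0%N); last by rewrite bin_small; lia.
by rewrite !exprS; ring.
Qed.

Lemma even_quad_tS m N :
  even_quad_t m.+2 N = p * even_quad_t m.+1 N + q * odd_quad_t m N.
Proof.
rewrite /odd_quad_t /even_quad_t !mulr_sumr -big_split.
apply: eq_bigr => k _ /=.
case: (leqP k m) => km; last first.
  by rewrite !bin_small; [ring|lia..].
have -> : (m.+2 - k.+1 = (m - k).+1)%N by lia.
have -> : (m.+1 - k.+1 = m - k)%N by lia.
have -> : (m.+3 - 3 * k.+1 = m - 3 * k)%N by lia.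
rewrite binS natrD.
case: (leqP (3 * k.+1) m.+2) => k3.
  have -> : (m - 3 * k = (m.+2 - 3 * k.+1).+1)%N by lia.
  by rewrite !exprS; ring.
rewrite (_ : 'C(m - k, (2 * k).+1) = 0%N); last by rewrite bin_small; lia.
by rewrite !exprS; ring.
Qed.

Lemma odd_quad_t_widen m N : (m %/ 3 < N)%N ->
  odd_quad_t m N = odd_quad_t m (m %/ 3).+1.
Proof.
move=> mN; rewrite /odd_quad_t (big_cat_nat (n := (m %/ 3).+1)) //=.
rewrite [X in _ + X]big_nat_cond [X in _ + X]big1 ?addr0 // => k.
by case/andP=> /andP[k1 k2] _; rewrite bin_small ?mul0r //; lia.
Qed.

Lemma even_quad_t_widen m N : (m.+1 %/ 3 <= N)%N ->
  even_quad_t m N = even_quad_t m (m.+1 %/ 3).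
Proof.
move=> mN; rewrite /even_quad_t (big_cat_nat (n := m.+1 %/ 3)) //=.
rewrite [X in _ + X]big_nat_cond [X in _ + X]big1 ?addr0 // => k.
by case/andP=> /andP[k1 k2] _; rewrite bin_small ?mul0r //; lia.
Qed.

Hypothesis alpha_neq0 : alpha != 0.

Lemma quad_t_odd m N : (m %/ 3 < N)%N ->
  quad_t n a b c m.*2.+1 = odd_quad_t m N.
Proof.
move=> /odd_quad_t_widen->; rewrite /quad_t /= odd_double /=.
rewrite -/alpha -/beta uphalf_double.
have -> : (m.*2.+1 %/ 6 = m %/ 3)%N by lia.
rewrite /odd_quad_t mulr_sumr !big_nat; apply: eq_bigr => k /= km.
have -> : n%:R / (a * (n - 3)%:R) = alpha^-1 by rewrite /alpha invf_div.
have -> : 'C(m - k, m - 3 * k) = 'C(m - k, 2 * k).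
  by rewrite -bin_sub; [congr 'C(_, _)|]; lia.
(* The prefactor is shared out: 2k factors turn c into q, m - 3k turn beta into p, and the last k
   cancel (- alpha)^k. *)
have -> : (- alpha^-1) ^+ m
    = (- alpha^-1) ^+ (2 * k) * (- alpha^-1) ^+ (m - 3 * k) * (- alpha^-1) ^+ k.
  by rewrite -!exprD; congr (_ ^+ _); lia.
have -> : q = c * - alpha^-1 by rewrite /q mulrN.
have -> : p = beta * - alpha^-1 by rewrite /p mulrN.
rewrite !exprMn.
have akk : (- alpha^-1) ^+ k * (- alpha) ^+ k = 1.
  by rewrite -exprMn mulrNN mulVf // expr1n.
rewrite -[RHS]mulr1 -[X in _ = _ * X]akk.
ring.
Qed.

Lemma quad_t_even m N : (m.+1 %/ 3 <= N)%N ->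
  quad_t n a b c m.*2 = even_quad_t m N.
Proof.
move=> /even_quad_t_widen->; rewrite /quad_t odd_double doubleK.
rewrite -/alpha -/beta.
have -> : ((m.*2 + 2) %/ 6 = m.+1 %/ 3)%N by lia.
rewrite big_add1 /even_quad_t mulr_sumr !big_nat; apply: eq_bigr => k /= km.
have -> : n%:R / (a * (n - 3)%:R) = alpha^-1 by rewrite /alpha invf_div.
have -> : 'C(m - k.+1, m.+1 - 3 * k.+1) = 'C(m - k.+1, (2 * k).+1).
  by rewrite -bin_sub; [congr 'C(_, _)|]; lia.
have -> : (2 * k.+1 - 1 = (2 * k).+1)%N by lia.
have -> : (- alpha^-1) ^+ m
    = (- alpha^-1) ^+ (2 * k).+1 * (- alpha^-1) ^+ (m.+1 - 3 * k.+1)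
      * (- alpha^-1) ^+ k.+1.
  by rewrite -!exprD; congr (_ ^+ _); lia.
have -> : q = c * - alpha^-1 by rewrite /q mulrN.
have -> : p = beta * - alpha^-1 by rewrite /p mulrN.
rewrite !exprMn.
have akk : (- alpha^-1) ^+ k.+1 * (- alpha) ^+ k.+1 = 1.
  by rewrite -exprMn mulrNN mulVf // expr1n.
rewrite -[RHS]mulr1 -[X in _ = _ * X]akk.
ring.
Qed.

(** The recurrence attached to x^3 = p x + q. Indices r.+3 and r.+1 have the same parity and r the
    other, which is why the odd and even sums refer to each other. *)
Lemma quad_tS r : quad_t n a b c r.+3
  = p * quad_t n a b c r.+1 + q * quad_t n a b c r.
Proof.
rewrite -[r]odd_double_half; case: (odd r) => /=; move: r./2 => m.
  rewrite !add1n -[X in quad_t n a b c X.+4]/(m.*2) -!doubleS.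
  rewrite (quad_t_even _ m.+1) ?(quad_t_even _ m.+1) //; try by lia.
  by rewrite (quad_t_odd _ m.+1) ?even_quad_tS //; lia.
rewrite !add0n -!doubleS.
rewrite (quad_t_odd _ m.+2) ?(quad_t_odd _ m.+2) //; try by lia.
by rewrite (quad_t_even _ m.+1) ?odd_quad_tS //; lia.
Qed.

(** Induction from t_0 = t_2 = 0 and t_1 = 1. Multiplying by x and replacing x^3 by p x + q shifts
    the coefficients, the new coefficient of x being p t_(r+1) + q t_r = t_(r+3). *)
Lemma quad_t_expr x r : alpha * x ^+ 3 + beta * x + c = 0 ->
  x ^+ r.+2 = quad_t n a b c r.+1 * x ^+ 2 + quad_t n a b c r.+2 * x
              + q * quad_t n a b c r.
Proof.
move=> gx.
have x3 : x ^+ 3 = p * x + q.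
  apply: (mulfI alpha_neq0); rewrite -[LHS]subr0 -gx /p /q.
  by field.
elim: r => [|r IHr].
  rewrite (quad_t_odd 0 1) // (quad_t_even 0 0) //.
  rewrite (quad_t_even 1 0) // /odd_quad_t /even_quad_t.
  by rewrite big_nat1 big_geq // big_geq // bin0 !expr0; ring.
by rewrite exprS IHr quad_tS; ring: x3.
Qed.

End QuadT.

(** * Root products over a closed field and Vieta's formulas *)

Lemma monic_croots (F : closedFieldType) (f : {poly F}) : f \is monic ->
  f = \prod_(z <- croots f) ('X - z%:P).
Proof.
move=> /monicP f1; rewrite /croots.
by case: closed_field_poly_normal => s /= {1}->; rewrite f1 scale1r.
Qed.

Lemma size_croots (F : closedFieldType) (f : {poly F}) : f \is monic ->
  size (croots f) = (size f).-1.
Proof. by move=> /monic_croots {2}->; rewrite size_prod_XsubC. Qed.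

Lemma monic_discriminant (F : closedFieldType) (f : {poly F}) : f \is monic ->
  discriminant f
  = (-1) ^+ 'C((size f).-1, 2) * \prod_(z <- croots f) f^`().[z].
Proof.
move=> f1; have fE := monic_croots _ _ f1.
rewrite [in f^`()]fE prod_horner_deriv size_croots // mulrA.
rewrite -expr2 sqrr_sign mul1r /discriminant (monicP f1) expr1n mul1r.
by rewrite size_croots.
Qed.

(** Skew symmetry of the resultant: both sides multiply the differences over all pairs, with
    opposite signs. *)
Lemma prod_horner_swap (R : comNzRingType) (s t : seq R) :
  \prod_(x <- s) (\prod_(y <- t) ('X - y%:P)).[x]
  = (-1) ^+ (size s * size t)
    * \prod_(y <- t) (\prod_(x <- s) ('X - x%:P)).[y].
Proof.
elim: s => [|x s IHs].
  rewrite big_nil mul0n mul1r big1 // => y _.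
  by rewrite big_nil hornerC.
rewrite big_cons {}IHs.
under [in RHS]eq_bigr do rewrite big_cons hornerM hornerXsubC.
rewrite big_split /= mulSn exprD horner_prod.
have -> : \prod_(y <- t) ('X - y%:P).[x] = (-1) ^+ size t * \prod_(y <- t) (y - x).
  elim: t => [|y t IHt]; first by rewrite !big_nil mulr1.
  by rewrite !big_cons IHt hornerXsubC exprS; ring.
ring.
Qed.

(** Vieta's formulas. The missing square term makes the roots sum to zero; solving for z turns
    symmetric identities in the roots into plain ring identities in x and y. *)
Lemma depressed_cubic_roots (F : closedFieldType) (u v w : F) : u != 0 ->
  exists x y z : F,
  [/\ u *: 'X^3 + v *: 'X + w%:P
        = u *: \prod_(y <- [:: x; y; z]) ('X - y%:P),
      z = - x - y, v = u * (x * y + (x + y) * z) & w = - (u * (x * y * z))].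
Proof.
move=> u0; set h : {poly F} := 'X^3 + ((v / u) *: 'X + (w / u)%:P).
have hs : (size ((v / u) *: 'X + (w / u)%:P : {poly F})%R
           < size ('X^3 : {poly F})%R)%N.
  rewrite size_polyXn; apply: leq_ltn_trans (size_polyD _ _) _.
  rewrite gtn_max (leq_ltn_trans (size_scale_leq _ _)) ?size_polyX //.
  by rewrite (leq_ltn_trans (size_polyC_leq1 _)).
have h1 : h \is monic by rewrite monicE lead_coefDl // lead_coefXn.
have hsz : size h = 4 by rewrite size_polyDl // size_polyXn.
have := monic_croots _ _ h1; have := size_croots _ _ h1; rewrite hsz.
case: (croots h) => [|x [|y [|z [|? ?]]]] // _ hE.
have hu : u *: h = u *: 'X^3 + v *: 'X + w%:P.
  rewrite /h !scalerDr addrA scalerA scale_polyC.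
  by rewrite ![u * (_ / u)]mulrC !divfK.
have hE' : h = 'X^3 - (x + y + z) *: 'X^2
               + (x * y + (x + y) * z) *: 'X - (x * y * z)%:P.
  rewrite hE !big_cons big_nil mulr1 -!mul_polyC !rmorphM !rmorphD /= !rmorphM.
  by rewrite !rmorphD /=; ring.
have hi i := congr1 (coefp i) hE'.
have := hi 0%N; have := hi 1%N; have := hi 2%N; rewrite /= /h !coefE /=.
rewrite !(mulr0, mulr1, oppr0, addr0, add0r) => /esym/eqP.
rewrite oppr_eq0 => /eqP xyz0 vuE wuE; exists x, y, z; split.
- by rewrite -hu hE.
- by rewrite -[LHS]subr0 -xyz0; ring.
- by rewrite -vuE mulrC divfK.
by rewrite -mulrN -wuE mulrC divfK.
Qed.

(** * The formula over a closed field in which n and n - 3 are invertible *)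

Lemma discriminant_quadrinomial (F : closedFieldType) (n : nat) (a b c : F) :
  (4 < n)%N -> n%:R != 0 :> F -> (n - 3)%:R != 0 :> F -> a != 0 -> c != 0 ->
  let t := quad_t n a b c in
  let A := 3%:R * a + n%:R * t (n - 2)%N in
  let alpha := a * (n - 3)%:R / n%:R in
  let beta := b * (n - 1)%:R / n%:R in
  let e1 := - (n%:R * t (n - 1)%N / A) in
  let e2 := (a * b * (n - 3)%:R - c * n%:R ^+ 2 * t (n - 3)%N)
            / (a * (n - 3)%:R * A) in
  A != 0 ->
  discriminant ('X^n + a *: 'X^3 + b *: 'X + c%:P) =
    (-1) ^+ ((n - 1) * (n + 2) %/ 2) * a ^+ (n - 3) * (n - 3)%:R ^+ (n - 3)
    * A ^+ 3
    * (alpha ^+ 2 * e2 ^+ 3 + alpha * beta * (e1 ^+ 2 - 2%:R * e2) * e2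
       + alpha * c * (e1 ^+ 3 - 3%:R * e1 * e2)
       + beta ^+ 2 * e2 + beta * c * e1 + c ^+ 2).
Proof.
move=> n4 n0 n30 a0 c0 t A alpha beta e1 e2 A0.
have alpha0 : alpha != 0 by rewrite !mulf_neq0 ?invr_neq0.
set f : {poly F} := 'X^n + _ + _ + _.
have fE : f = 'X^n + (a *: 'X^3 + b *: 'X + c%:P) by rewrite /f !addrA.
have hs : (size (a *: 'X^3 + b *: 'X + c%:P : {poly F})%R
           < size ('X^n : {poly F})%R)%N.
  rewrite size_polyXn; apply: leq_ltn_trans (size_polyD _ _) _.
  rewrite gtn_max (leq_ltn_trans (size_polyC_leq1 _)) ?andbT; last by lia.
  apply: leq_ltn_trans (size_polyD _ _) _; rewrite gtn_max.
  by rewrite !(leq_ltn_trans (size_scale_leq _ _)) ?size_polyX ?size_polyXn //; lia.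
have f1 : f \is monic by rewrite fE monicE lead_coefDl // lead_coefXn.
have sizef : size f = n.+1 by rewrite fE size_polyDl // size_polyXn.
rewrite monic_discriminant // sizef /=.
have fprod := monic_croots _ _ f1; have := size_croots _ _ f1.
rewrite sizef /=; move: (croots f) fprod => s fprod sizes.
have dfE x : f^`().[x] = n%:R * x ^+ n.-1 + 3%:R * a * x ^+ 2 + b.
  rewrite /f !derivD !derivZ derivC derivX !derivXn !(hornerD, hornerZ).
  rewrite !hornerMn !hornerXn !hornerC /=.
  by ring.
have fxE x : f.[x] = x ^+ n + a * x ^+ 3 + b * x + c.
  by rewrite !(hornerD, hornerZ, hornerXn, hornerX, hornerC).
have n3E : (n - 3)%:R = n%:R - 3%:R :> F by rewrite natrB //; lia.
have n1E : (n - 1)%:R = n%:R - 1 :> F by rewrite natrB //; lia.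
pose g : {poly F} := alpha *: 'X^3 + beta *: 'X + c%:P.
have gE x : n%:R * g.[x] = n%:R * f.[x] - x * f^`().[x].
  rewrite dfE fxE !(hornerD, hornerZ, hornerXn, hornerX, hornerC) /alpha /beta n3E n1E.
  have -> : x ^+ n = x * x ^+ n.-1 by rewrite -exprS; congr (_ ^+ _); lia.
  by field.
have prod_s : \prod_(x <- s) x = (-1) ^+ n * c.
  have <- : f.[0] = c.
    by rewrite fxE !expr0n gtn_eqF ?(ltn_trans _ n4) //= !mulr0 !add0r.
  rewrite fprod horner_prod -sizes; elim: (s) => [|x s' IHs].
    by rewrite !big_nil mulr1.
  by rewrite !big_cons IHs hornerXsubC /= exprS; ring.
(* The relation x f' = - n g multiplied over the roots of f; the factors x give the constant term up
   to sign. *)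
have prod_df : (-1) ^+ n * c * \prod_(x <- s) f^`().[x]
               = (- n%:R) ^+ n * \prod_(x <- s) g.[x].
  have : {in s, forall x, x * f^`().[x] = - n%:R * g.[x]}.
    move=> x xs; have fx : f.[x] = 0.
      by apply/rootP; rewrite fprod root_prod_XsubC.
    by rewrite mulNr gE fx; ring.
  rewrite -prod_s -big_split -[X in _ ^+ X]sizes /=; elim: (s) => [|x s' IHs] sP.
    by rewrite !big_nil mulr1.
  rewrite !big_cons /= sP ?mem_head // IHs; first by rewrite exprS; ring.
  by move=> z zs; rewrite sP // in_cons zs orbT.
have [x [y [z [gprod zE betaE cE]]]] := depressed_cubic_roots _ _ beta c alpha0.
have prod_g : \prod_(x <- s) g.[x]
              = alpha ^+ n * ((-1) ^+ (n * 3) * (f.[x] * f.[y] * f.[z])).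
  rewrite /g gprod.
  have -> : f.[x] * f.[y] * f.[z]
            = \prod_(w <- [:: x; y; z]) (\prod_(v <- s) ('X - v%:P)).[w].
    by rewrite -fprod !big_cons big_nil mulr1 mulrA.
  rewrite -sizes -(prod_horner_swap _ s [:: x; y; z]).
  set h := \prod_(v <- [:: x; y; z]) _.
  elim: (s) => [|w s' IHs]; first by rewrite !big_nil mulr1.
  by rewrite !big_cons IHs hornerZ /= exprS; ring.
have f_root w : g.[w] = 0 -> f.[w] = w * (A * (w ^+ 2 - e1 * w + e2)) / n%:R.
  move=> gw; apply: (mulIf n0); rewrite divfK // mulrC.
  have := gE w; rewrite gw mulr0 => /esym/eqP; rewrite subr_eq0 => /eqP->.
  congr (w * _); rewrite dfE.
  (* Reducing x^(n-1) makes the coefficients of f' equal to A, n t_(n-1) = - A e1 and b - n c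
     t_(n-3) / alpha = A e2. *)
  have -> : n.-1 = (n - 3).+2 by lia.
  rewrite (quad_t_expr _ n a b c alpha0 _ (n - 3)%N); last by rewrite -gw !hornerE.
  have -> : (n - 3).+2 = (n - 1)%N by lia.
  have -> : (n - 3).+1 = (n - 2)%N by lia.
  rewrite -/t -/alpha [A * _]mulrDr [A * (_ - _)]mulrBr.
  have -> : A * (e1 * w) = - (n%:R * t (n - 1)%N) * w by rewrite /e1; field.
  have -> : A * e2 = b - n%:R * c * t (n - 3)%N / alpha.
    by rewrite /e2 /alpha; field; rewrite A0 n30 a0 n0.
  by rewrite /A; field.
have g_root w : w \in [:: x; y; z] -> g.[w] = 0.
  move=> wxyz; apply/rootP; rewrite /g gprod rootZ //.
  by rewrite root_prod_XsubC.
(* (n - 1)(n + 2) / 2 = n (n - 1) / 2 + (n - 1). *)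
have sgn : (-1) ^+ ((n - 1) * (n + 2) %/ 2) = (-1) ^+ 'C(n, 2) * (-1) ^+ (n - 1) :> F.
  rewrite -exprD; congr (_ ^+ _); rewrite bin2 -divn2.
  by rewrite [RHS]addnC -divnMDl //; congr (_ %/ _)%N; nia.
set G := alpha ^+ 2 * e2 ^+ 3 + _ + _ + _ + _ + _.
rewrite sgn -!mulrA; congr (_ * _).
pose Q w := w ^+ 2 - e1 * w + e2.
(* If r1, r2 are the roots of Q, with elementary symmetric functions e1 and e2, then G is g(r1)
   g(r2) expanded. *)
have GE : G = alpha ^+ 2 * (Q x * Q y * Q z).
  by rewrite /G /Q betaE cE zE; ring.
have sc0 : (-1) ^+ n * c != 0 by rewrite mulf_neq0 ?signr_eq0.
apply: (mulfI sc0).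
rewrite prod_df prod_g !f_root ?g_root ?inE ?eqxx ?orbT // -!/(Q _) GE.
(* Writing c as - alpha x y z on the right matches the factor x y z of f(x) f(y) f(z). Of alpha^n,
   three factors go to this c and to the alpha^2 in G; of n^n, three cancel the denominators of
   [f_root]. What is left is (alpha n)^(n-3) = (a (n - 3))^(n-3). *)
rewrite [X in _ = _ * X * _]cE [(- n%:R) ^+ n]exprNn.
have sgn1 : (-1) ^+ n = - (-1) ^+ (n - 1) :> F.
  by rewrite -[RHS]mulN1r -exprS; congr (_ ^+ _); lia.
have expn3 (w : F) : w ^+ n = w ^+ 3 * w ^+ (n - 3).
  by rewrite -exprD; congr (_ ^+ _); lia.
have sgn3 : (-1) ^+ (n * 3) = (-1) ^+ n :> F.
  by rewrite -signr_odd oddM andbT signr_odd.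
have alphan : alpha ^+ (n - 3) * n%:R ^+ (n - 3)
              = a ^+ (n - 3) * (n - 3)%:R ^+ (n - 3).
  by rewrite -!exprMn divfK.
rewrite (expn3 n%:R) (expn3 alpha) sgn3 sgn1 [a ^+ _ * (_ * _)]mulrA -alphan.
by field.
Qed.

(** [ht] states that the denominators of e1 and e2 do not vanish, which the formula presupposes. *)
Theorem theorem5p3 (R : realType) (n : nat) (a b c : R[i])
  (hn : (4 < n)%N) (habc : a * b * c != 0)
  (ht : 3%:R * a + n%:R * quad_t n a b c (n - 2) != 0) :
  let t := quad_t n a b c in
  let f : {poly R[i]} := 'X^n + a *: 'X^3 + b *: 'X + c%:P in
  let e1 := - (n%:R * t (n - 1)%N / (3%:R * a + n%:R * t (n - 2)%N)) in
  let e2 := (a * b * (n - 3)%:R - c * n%:R ^+ 2 * t (n - 3)%N)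
            / (a * (n - 3)%:R * (3%:R * a + n%:R * t (n - 2)%N)) in
  discriminant f =
    (-1) ^+ ((n - 1) * (n + 2) %/ 2) * a ^+ (n - 3) * (n - 3)%:R ^+ (n - 3)
    * (3%:R * a + n%:R * t (n - 2)%N) ^+ 3
    * ((a * (n - 3)%:R / n%:R) ^+ 2 * e2 ^+ 3
       + a * b * (n - 1)%:R * (n - 3)%:R / n%:R ^+ 2
         * (e1 ^+ 2 - 2%:R * e2) * e2
       + a * c * (n - 3)%:R / n%:R * (e1 ^+ 3 - 3%:R * e1 * e2)
       + (b * (n - 1)%:R / n%:R) ^+ 2 * e2
       + b * c * (n - 1)%:R / n%:R * e1
       + c ^+ 2).
Proof.
move=> t f e1 e2.
have n0 : n%:R != 0 :> R[i] by rewrite Num.Theory.pnatr_eq0; lia.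
have n30 : (n - 3)%:R != 0 :> R[i] by rewrite Num.Theory.pnatr_eq0; lia.
move: habc; rewrite !mulf_eq0 !negb_or => /andP[/andP[a0 _] c0].
rewrite /f (discriminant_quadrinomial _ _ _ _ _ hn n0 n30 a0 c0 ht).
rewrite -/t -/e1 -/e2; congr (_ * _).
by field.
Qed.
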